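(* For every positive integer $n$, there is a coloring of the edge set $E(Q_n)$ of the $n$-dimensional hypercube $Q_n$ using $4$ colors such that there is no induced monochromatic $C_4$, $C_6$, or $C_{10}$; that is, for each $l\in\{4,6,10\}$, no cycle of length $l$ in $Q_n$ that is an induced subgraph of $Q_n$ has all of its edges of the same color.
   Context: $Q_n$ is the graph whose vertices are the binary sequences of length $n$ (equivalently, the subsets of $[n]=\{1,\ldots,n\}$), two vertices being adjacent if and only if the sequences differ in exactly one position (equivalently, the symmetric difference of the sets has size $1$). $C_l$ denotes a cycle of length $l$. The coloring is an arbitrary assignment of colors to edges (not necessarily a proper edge coloring). *)

(* Defs.v *)
From mathcomp Require Import all_boot.

Set Implicit Arguments.
Unset Strict Implicit.
Unset Printing Implicit Defensive.

(* A graph on a finite vertex type T is given by its adjacency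
   relation e : rel T; edges are unordered pairs of vertices. *)

Definition edge_set (T : finType) (e : rel T) : {set {set T}} :=
  [set [set u.1; u.2] | u in [pred u : T * T | e u.1 u.2]].

Definition edge (T : finType) (e : rel T) : Type :=
  {a : {set T} | a \in edge_set e}.

(* The sequence s lists the vertices of a cycle in cyclic order. *)
Definition cycle_edges (T : finType) (s : seq T) : {set {set T}} :=
  [set [set x; next s x] | x in s].

(* The cycle has at least three vertices, so that s is a cycle of a simple
   graph and not a single vertex or an edge traversed back and forth. *)
Definition is_cycle (T : finType) (e : rel T) (l : nat) (s : seq T) : Prop :=
  [/\ 2 < l, size s = l & ucycle e s].

Definition induced_cycle (T : finType) (e : rel T) (l : nat) (s : seq T) :
    Prop :=
  is_cycle e l s /\
  {in s &, forall x y : T, e x y -> [set x; y] \in cycle_edges s}.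

Definition monochromatic (T : finType) (e : rel T) (C : Type)
    (c : edge e -> C) (s : seq T) : Prop :=
  exists k : C, forall a : edge e, val a \in cycle_edges s -> c a = k.

Definition hypercube (n : nat) : rel {set 'I_n} :=
  fun A B => #|(A :\: B) :|: (B :\: A)| == 1.

Arguments hypercube n _ _ : clear implicits.

(* Main.v *)
Require Import Defs.
From mathcomp Require Import all_boot.

Set Implicit Arguments.
Unset Strict Implicit.
Unset Printing Implicit Defensive.

(** Colour the edge that adds [i] to a set [A] by two parities: that of the
    number of elements of [A] smaller than [i], and that of the number of
    elements larger than [i].

    A cycle of length [l] is a starting vertex together with the word of the
    [l] directions flipped along it ([is_cycle_word]), and all that matters
    can be read off this word:
    - the walk closes up, so every letter occurs an even number of times;
    - the cycle is induced, so the two ends of an arc with between 2 and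
      [l - 2] edges are at distance at least 2: at least two letters occur an
      odd number of times in the corresponding factor
      ([nearly_closed_walk], [induced_cycle_chord]);
    - the cycle is monochromatic, so between two edges of direction [i] an
      even number of directions below [i] and an even number of directions
      above [i] are flipped ([parity_colour_balanced]).
    These conditions depend only on the relative order of the letters, of which
    there are at most [l / 2 <= 5]. The theorem is thus a finite statement about
    words over five letters, settled by a backtracking search
    ([no_admissible_closed_word]).

    That the search fails can be understood as follows. Cyclically, an even
    number of letters separates consecutive occurrences of a letter, and any
    three consecutive letters are distinct when [l > 4]. For [l = 4] the word
    is [abab], where [b] alone separates the two [a]. For [l = 6] it is
    [abcabc], where exactly one letter below the median letter separates the
    two occurrences of the latter. For [l = 10] every letter occurs twice, so
    write [1 < 2 < 3 < 4 < 5] for the letters and say that two of them cross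
    when their occurrences alternate. Each letter crosses an even number of
    smaller and an even number of larger letters, and it crosses some letter,
    as otherwise the factor between its occurrences would be a closed walk.
    Hence 1 and 2 do not cross, nor do 4 and 5, while 3 crosses both or none of
    1 and 2, and both or none of 4 and 5. If 3 does not cross 1 and 2, then
    these cross 4 and 5, which therefore do not cross 3, and 3 crosses nothing;
    symmetrically for 4 and 5. So 3 crosses all the others, and the remaining
    crossings match 1 and 2 with 4 and 5. Up to rotation the word is then
    [3aa'bb'3bb'aa'], with [{a, a'}] and [{b, b'}] the matched pairs, and in
    its factor [bb'3bb'] only 3 occurs an odd number of times. *)

(** * Words of directions *)

(** At most one letter has odd multiplicity in the nonempty word [u]: walking
    along [u] leads back to the start or to one of its neighbours. Naming the
    exceptional letter, rather than counting, makes this visibly invariant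
    under relabelling. *)
Definition nearly_closed (u : seq nat) : bool :=
  has (fun a => all (fun b => odd (count_mem b u) ==> (b == a)) u) u.

Definition parity_balanced (a : nat) (u : seq nat) : bool :=
  ~~ odd (count (ltn^~ a) u) && ~~ odd (count (ltn a) u).

(** The two conditions on the factors starting at the first letter of
    [a :: u]. The factor [a :: take k.+1 u] has [k.+2] letters, so that
    [k.+3 < l] says that it has at most [l - 2] of them. *)
Definition admissible_head (l a : nat) (u : seq nat) : bool :=
  all (fun k => ((k.+3 < l) ==> ~~ nearly_closed (a :: take k.+1 u)) &&
                ((nth 0 u k == a) ==> parity_balanced a (take k u)))
      (iota 0 (size u)).

(** Every factor of a word begins some suffix, so constraining heads
    constrains all factors; this form lets a search that extends words on
    the left check only the new letter. *)
Fixpoint admissible (l : nat) (w : seq nat) : bool :=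
  if w is a :: u then admissible_head l a u && admissible l u else true.

Lemma admissible_catr l v u : admissible l (v ++ u) -> admissible l u.
Proof. by elim: v => //= a v IH /andP[_ /IH]. Qed.

(** Backtracking over the [k] letters below [m] still to be added in front of
    [u]: every completion violates admissibility or has a letter of odd
    multiplicity. The conditional, unlike [==>], does not explore a branch
    already refuted when evaluation is strict. *)
Fixpoint no_closed_extension (l m k : nat) (u : seq nat) : bool :=
  if k is k'.+1 then
    all (fun a => if admissible_head l a u
                  then no_closed_extension l m k' (a :: u) else true)
        (iota 0 m)
  else has (fun a => odd (count_mem a u)) u.

(** Letters are added on the left, so [v] is consumed from its right end. *)
Lemma no_closed_extensionP l m k u v :
    no_closed_extension l m k u -> size v = k -> all (ltn^~ m) v ->
    admissible l (v ++ u) ->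
  has (fun a => odd (count_mem a (v ++ u))) (v ++ u).
Proof.
elim: k u v => [|k IH] u v /=; first by move=> + /size0nil-> /=.
case/lastP: v => // v a /allP search; rewrite size_rcons => -[szv].
rewrite all_rcons cat_rcons => /andP[lt_a lt_v] adm.
apply: IH => //; have /= /andP[head_a _] := admissible_catr adm.
by have := search a; rewrite mem_iota head_a; apply.
Qed.

Lemma mono_ltn_eq (f : nat -> nat) (w : seq nat) :
    {in w &, {mono f : a b / a < b}} ->
  {in w &, forall a b, (f a == f b) = (a == b)}.
Proof.
move=> f_mono a b aw bw; apply/eqP/eqP => [eq_f|->//].
have := f_mono a b aw bw; have := f_mono b a bw aw.
by rewrite eq_f ltnn; case: ltngtP.
Qed.

(** Admissibility involves letters only through their relative order. *)
Lemma admissible_map l (f : nat -> nat) w :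
    {in w &, {mono f : a b / a < b}} -> admissible l w ->
  admissible l (map f w).
Proof.
elim: w => //= a u IH f_mono /andP[head_a adm_u].
have f_inj := mono_ltn_eq f_mono.
have count_f (b : nat) v : b \in a :: u -> {subset v <= a :: u} ->
    count_mem (f b) (map f v) = count_mem b v.
  by move=> bin sub; rewrite count_map; apply: eq_in_count => c /sub cin /=;
    rewrite f_inj.
apply/andP; split; last first.
  by apply: IH => // b c bu cu; rewrite f_mono // inE ?bu ?cu orbT.
apply/allP => k; rewrite mem_iota size_map => lt_k.
have := allP head_a k; rewrite mem_iota => /(_ lt_k) /andP[arc bal].
have sub : {subset a :: take k.+1 u <= a :: u}.
  by move=> b; rewrite !inE => /predU1P[->|/mem_take->]; rewrite ?eqxx ?orbT.
have subk : {subset take k u <= a :: u}.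
  by move=> b /mem_take bu; rewrite inE bu orbT.
have ain : a \in a :: u by rewrite mem_head.
have nthin : nth 0 u k \in a :: u by rewrite inE mem_nth ?orbT.
rewrite -!map_take (nth_map 0) // f_inj //; apply/andP; split.
  apply/implyP => /(implyP arc); apply: contra.
  rewrite -/(map f (a :: take k.+1 u)) /nearly_closed has_map.
  case/hasP => b bin /allP closed; apply/hasP; exists b => //.
  apply/allP => c cin; have := closed (f c) (map_f f cin).
  by rewrite count_f ?f_inj //; apply: sub.
apply/implyP => /(implyP bal); rewrite /parity_balanced !count_map.
have eq_lt : count (preim f (ltn^~ (f a))) (take k u) = count (ltn^~ a) (take k u).
  by apply: eq_in_count => b /subk bin /=; rewrite f_mono.
have eq_gt : count (preim f (ltn (f a))) (take k u) = count (ltn a) (take k u).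
  by apply: eq_in_count => b /subk bin /=; rewrite f_mono.
by rewrite eq_lt eq_gt.
Qed.

Definition rank (w : seq nat) (a : nat) : nat := count (ltn^~ a) (undup w).

Lemma rank_mono w : {in w &, {mono rank w : a b / a < b}}.
Proof.
have rank_lt a b : a \in w -> a < b -> rank w a < rank w b.
  move=> aw lt_ab; rewrite /rank.
  have /permP/(_ (ltn^~ b))-> : perm_eq (undup w) (a :: rem a (undup w)).
    by rewrite perm_to_rem // mem_undup.
  have /permP/(_ (ltn^~ a))-> : perm_eq (undup w) (a :: rem a (undup w)).
    by rewrite perm_to_rem // mem_undup.
  rewrite /= ltnn lt_ab add0n add1n ltnS; apply: sub_count => c /= lt_ca.
  exact: ltn_trans lt_ab.
move=> a b aw bw; case: (ltngtP a b) => [|lt_ba|->]; last by rewrite ltnn.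
  exact: rank_lt.
by apply/negbTE; rewrite -leqNgt ltnW ?rank_lt.
Qed.

Lemma rank_lt_size w a : a \in w -> rank w a < size (undup w).
Proof.
move=> aw; have aw' : a \in undup w by rewrite mem_undup.
rewrite /rank (permP (perm_to_rem aw')) (perm_size (perm_to_rem aw')) /=.
by rewrite ltnn ltnS count_size.
Qed.

(** Each letter that occurs does so at least twice, so two copies of the list
    of letters form a sub-multiset of [w]. *)
Lemma size_undup_even (w : seq nat) :
  (forall a, ~~ odd (count_mem a w)) -> (size (undup w)).*2 <= size w.
Proof.
move=> even_w.
suff /count_subseqP[v sub_v /perm_size eq_sz] :
    forall a, count_mem a (undup w ++ undup w) <= count_mem a w.
  by rewrite -addnn -size_cat eq_sz size_subseq.
move=> a; rewrite count_cat count_uniq_mem ?undup_uniq // mem_undup -has_pred1 has_count.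
by have := even_w a; case: (count_mem a w) => [|[|]].
Qed.

(** Replacing each letter by its rank among the letters of [w] gives a word
    over [0, ..., 4], and the search over those words is a computation. *)
Lemma no_admissible_closed_word l w :
    l \in [:: 4; 6; 10] -> size w = l -> (forall a, ~~ odd (count_mem a w)) ->
  ~~ admissible l w.
Proof.
move=> l_val sz_w even_w; apply/negP => adm.
have := admissible_map (@rank_mono w) adm; set v := map _ w => adm_v.
have small : size (undup w) <= 5.
  rewrite -leq_double (leq_trans (size_undup_even even_w)) // sz_w.
  by move: l_val; rewrite !inE => /or3P[] /eqP->.
have lt_v : all (ltn^~ 5) v.
  apply/allP => _ /mapP[a aw ->] /=.
  exact: leq_trans (rank_lt_size aw) small.
have search : no_closed_extension l 5 l [::].
  by move: l_val; rewrite !inE => /or3P[] /eqP->; vm_compute.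
have := no_closed_extensionP search _ lt_v; rewrite size_map cats0.
move=> /(_ sz_w adm_v) /hasP[_ /mapP[a aw ->]].
rewrite count_map (eq_in_count (a2 := pred1 a)) ?(negbTE (even_w a)) //.
by move=> b bw /=; rewrite (mono_ltn_eq (@rank_mono w)).
Qed.

(** * Walks in the hypercube *)

Section Walks.

Variable n : nat.
Implicit Types (A B : {set 'I_n}) (i : 'I_n) (u w : seq 'I_n).

Definition flip A i : {set 'I_n} := [set j | (j \in A) (+) (j == i)].

Lemma hypercubeP A B : reflect (exists i, B = flip A i) (hypercube n A B).
Proof.
apply: (iffP cards1P) => [[i /setP diff]|[i ->]]; exists i; apply/setP => j.
  by have := diff j; rewrite !inE; case: (j \in A); case: (j \in B);
    case: (j == i).
by rewrite !inE; case: (j \in A); case: (j == i).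
Qed.

Lemma in_walk A u i : (i \in foldl flip A u) = (i \in A) (+) odd (count_mem i u).
Proof.
elim: u A => [|j u IH] A /=; first by rewrite addbF.
by rewrite IH inE oddD oddb addbA eq_sym.
Qed.

(** Each flip of an element satisfying [P] changes the cardinal by one. *)
Lemma odd_card_walk A u (P : pred 'I_n) :
  odd #|[set j in foldl flip A u | P j]|
    = odd #|[set j in A | P j]| (+) odd (count P u).
Proof.
elim: u A => [|i u IH] A /=; first by rewrite addbF.
rewrite IH oddD oddb addbA; congr (_ (+) _).
case: (boolP (P i)) => Pi; last first.
  rewrite addbF; congr (odd #|pred_of_set _|); apply/setP => j; rewrite !inE.
  by case: eqP => [->|_]; rewrite ?(negbTE Pi) ?andbF // addbF.
case: (boolP (i \in A)) => iA.
  rewrite [in RHS](cardsD1 i) inE iA Pi oddD /= addbT negbK.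
  congr (odd #|pred_of_set _|); apply/setP => j; rewrite !inE.
  by case: eqP => [->|_]; rewrite ?iA // addbF.
rewrite [in LHS](cardsD1 i) !inE (negbTE iA) eqxx Pi oddD /= addbT; congr (~~ _).
congr (odd #|pred_of_set _|); apply/setP => j; rewrite !inE.
by case: eqP => [->|_]; rewrite ?(negbTE iA) // addbF.
Qed.

Lemma path_walk A (p : seq {set 'I_n}) :
  path (hypercube n) A p -> exists w, p = scanl flip A w.
Proof.
elim: p A => [|B p IH] A /=; first by exists [::].
by case/andP => /hypercubeP[i ->] /IH[w ->]; exists (i :: w).
Qed.

Lemma nearly_closed_walk A u : nearly_closed (map val u) ->
  foldl flip A u = A \/ hypercube n A (foldl flip A u).
Proof.
rewrite /nearly_closed has_map => /hasP[i iu /allP closed].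
have odd_i j : odd (count_mem j u) -> j = i.
  move=> odd_j; have ju : j \in u by rewrite -has_pred1 has_count odd_gt0.
  have := closed _ (map_f val ju); rewrite count_map.
  rewrite (eq_count (a2 := pred1 j)) ?odd_j => [/eqP/val_inj//|k /=].
  by rewrite val_eqE.
case odd_ui: (odd (count_mem i u)); [right; apply/hypercubeP; exists i|left].
  apply/setP => j; rewrite in_walk inE; congr (_ (+) _).
  by apply/idP/eqP => [/odd_i|->].
apply/setP => j; rewrite in_walk; case odd_j: (odd _); last by rewrite addbF.
by rewrite -(odd_i j odd_j) odd_j in odd_ui.
Qed.

End Walks.

(** * The colouring *)

Section Colouring.

Variable n : nat.
Implicit Types (A B : {set 'I_n}) (i : 'I_n) (e : {set {set 'I_n}}).

(** An edge is an unordered pair of sets. Its smaller end is recovered as the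
    intersection, so that the parities below do not depend on an
    orientation. *)
Definition lower e : {set 'I_n} := \bigcap_(A in e) A.
Definition flipped e : {set 'I_n} := cover e :\: lower e.

Definition left_parity e : bool :=
  odd #|[set j in lower e | [exists i in flipped e, j < i]]|.
Definition right_parity e : bool :=
  odd #|[set j in lower e | [exists i in flipped e, i < j]]|.

Definition parity_colour e : 'I_4 :=
  inord (left_parity e + (right_parity e).*2).

Lemma parity_colour_inj e1 e2 : parity_colour e1 = parity_colour e2 ->
  left_parity e1 = left_parity e2 /\ right_parity e1 = right_parity e2.
Proof.
rewrite /parity_colour => /(congr1 val) /=.
by case: (left_parity e1) (right_parity e1) => -[];
  case: (left_parity e2) (right_parity e2) => -[]; rewrite !inordK.
Qed.

Lemma lower_flip A i : lower [set A; flip A i] = A :\ i.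
Proof.
apply/setP => j; apply/bigcapP/idP => [in_all|].
  have := in_all _ (set21 A _); have := in_all _ (set22 A (flip A i)).
  by rewrite !inE; case: (j \in A) => //; case: (j == i).
by rewrite in_setD1 => /andP[ji jA] B /set2P[]->; rewrite ?inE ?jA ?(negbTE ji).
Qed.

Lemma flipped_flip A i : flipped [set A; flip A i] = [set i].
Proof.
apply/setP => j; rewrite /flipped lower_flip in_setD in_set1.
have -> : (j \in cover [set A; flip A i]) = (j \in A) || (j \in flip A i).
  apply/bigcupP/orP => [[B /set2P[]-> ->]|[]]; [by left|by right| |].
    by exists A; rewrite ?set21.
  by exists (flip A i); rewrite ?set22.
by rewrite !inE; case: (j \in A); case: (j == i).
Qed.

Lemma left_parity_flip A i :
  left_parity [set A; flip A i] = odd #|[set j in A | j < i]|.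
Proof.
rewrite /left_parity lower_flip flipped_flip.
congr (odd #|pred_of_set _|); apply/setP => j; rewrite !inE.
have -> : [exists k in [set i], j < k] = (j < i).
  apply/exists_inP/idP => [[k /set1P->]//|ji]; exists i => //; exact: set11.
by case: eqP => //= ->; rewrite ltnn andbF.
Qed.

Lemma right_parity_flip A i :
  right_parity [set A; flip A i] = odd #|[set j in A | i < j]|.
Proof.
rewrite /right_parity lower_flip flipped_flip.
congr (odd #|pred_of_set _|); apply/setP => j; rewrite !inE.
have -> : [exists k in [set i], k < j] = (i < j).
  apply/exists_inP/idP => [[k /set1P->]//|ji]; exists i => //; exact: set11.
by case: eqP => //= ->; rewrite ltnn andbF.
Qed.

(** [B] is the vertex where direction [i] is flipped again after the walk
    [u]. The first flip of [i] itself changes neither the elements below [i]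
    nor those above it, so [u] accounts for the whole change of the
    parities. *)
Lemma parity_colour_balanced A i u (B := foldl (@flip n) (flip A i) u) :
    parity_colour [set A; flip A i] = parity_colour [set B; flip B i] ->
  parity_balanced i (map val u).
Proof.
case/parity_colour_inj.
rewrite !left_parity_flip !right_parity_flip /B.
rewrite -[flip A i]/(foldl (@flip n) A [:: i]) -foldl_cat !odd_card_walk /=.
rewrite !ltnn !add0n /parity_balanced !count_map.
have -> : count (preim val (ltn^~ i)) u = count (fun j : 'I_n => j < i) u.
  exact: eq_count.
have -> : count (preim val (ltn i)) u = count (fun j : 'I_n => i < j) u.
  exact: eq_count.
by do 2![case: (odd #|_|); case: (odd (count _ _))].
Qed.

End Colouring.

(** * Induced cycles as words *)

(** The recursive definition of admissibility, restated in terms of the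
    factorisations of a word of directions. *)
Lemma admissible_arcs n l (w : seq 'I_n) :
    (forall v u t, w = v ++ u ++ t -> 1 < size u -> (size u).+1 < l ->
       ~~ nearly_closed (map val u)) ->
    (forall v i u t, w = v ++ i :: u ++ i :: t ->
       parity_balanced i (map val u)) ->
  admissible l (map val w).
Proof.
elim: w => //= i w IH arcs bal; apply/andP; split; last first.
  apply: IH => [v u t eq_w|v j u t eq_w].
    by apply: (arcs (i :: v) u t); rewrite eq_w.
  by apply: (bal (i :: v) j u t); rewrite eq_w.
apply/allP => k; rewrite mem_iota size_map => lt_k; apply/andP; split.
  apply/implyP => lt_kl; rewrite -map_take.
  have sz : size (take k.+1 w) = k.+1 by rewrite size_takel.
  apply: (arcs [::] (i :: take k.+1 w) (drop k.+1 w)); rewrite /= ?sz //.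
  by rewrite cat_take_drop.
rewrite (nth_map i) // -map_take; apply/implyP => /eqP/val_inj nth_k.
apply: (bal [::] i _ (drop k.+1 w)) => /=; congr (_ :: _).
by rewrite -[in X in _ ++ X :: _]nth_k -drop_nth ?cat_take_drop.
Qed.

Lemma next_nth_mod (T : eqType) (x0 : T) s k : uniq s -> k < size s ->
  next s (nth x0 s k) = nth x0 s (k.+1 %% size s).
Proof.
case: s => // x s uniq_s lt_k; rewrite next_nth mem_nth // index_uniq //.
have [lt_ks|ge_ks] := ltnP k (size s).
  by rewrite modn_small //=; apply: set_nth_default.
have -> : k = size s by apply/eqP; rewrite eqn_leq ge_ks andbT.
by rewrite modnn nth_default.
Qed.

(** Vertices at least two steps apart both ways around an induced cycle are
    distinct and not adjacent. Position [k = l] is allowed, and denotes the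
    starting vertex, so that arcs ending there need no separate treatment. *)
Lemma induced_cycle_chord (T : finType) (e : rel T) l s x0 j k :
    induced_cycle e l s -> j.+1 < k -> k <= l -> k.+1 < j + l ->
    let x := nth x0 s j in let y := nth x0 s (k %% l) in
  x <> y /\ ~~ e x y.
Proof.
move=> [[l_gt2 sz_s /andP[_ uniq_s]] induced] lt_jk le_kl lt_kjl x y.
have l_gt0 : 0 < l by apply: leq_trans l_gt2.
have lt_jl : j < l by apply: leq_trans le_kl; apply: ltnW.
have lt_ml m : m %% l < size s by rewrite sz_s ltn_mod.
have lt_js : j < size s by rewrite sz_s.
have neq_jk : (j == k %% l) = false.
  apply/negbTE; move: le_kl; rewrite leq_eqVlt => /predU1P[eq_kl|lt_kl].
    rewrite eq_kl modnn; apply: contraTneq lt_kjl => ->.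
    by rewrite eq_kl add0n -leqNgt leqnSn.
  by rewrite modn_small // neq_ltn (ltn_trans _ lt_jk).
split; first by apply/eqP; rewrite nth_uniq // neq_jk.
apply/negP => /(induced x y (mem_nth _ lt_js) (mem_nth _ (lt_ml k))).
case/imsetP => z /(nthP x0)[a lt_as <-]; rewrite next_nth_mod // sz_s.
move/setP => eq_xy; have := eq_xy x; have := eq_xy y.
rewrite !inE !eqxx !orbT /= !nth_uniq //.
have lt_al : a < l by rewrite -sz_s.
move=> /esym k_a /esym j_a.
(* Either [j = a] and [k] follows [a], or the reverse; both contradict the
   distance between [j] and [k], and the mixed cases contradict [j <> k]. *)
case/orP: j_a => /eqP j_a; case/orP: k_a => /eqP k_a.
- by rewrite -j_a in k_a; rewrite k_a eqxx in neq_jk.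
- move: k_a; rewrite -j_a (@modn_small j.+1); last exact: leq_trans le_kl.
  move: le_kl; rewrite leq_eqVlt => /predU1P[->|lt_kl]; first by rewrite modnn.
  by rewrite modn_small // => eq_kj; rewrite eq_kj ltnn in lt_jk.
- move: j_a; rewrite -k_a; move: le_kl; rewrite leq_eqVlt => /predU1P[eq_kl|lt_kl].
    rewrite eq_kl modnn modn_small ?(ltn_trans _ l_gt2) // => j1.
    by rewrite eq_kl j1 add1n ltnn in lt_kjl.
  rewrite (modn_small lt_kl); move: (lt_kl); rewrite leq_eqVlt => /predU1P[eq_kl|lt_k1l].
    by rewrite eq_kl modnn => j0; rewrite eq_kl j0 ltnn in lt_kjl.
  rewrite modn_small // => eq_jk.
  by move: lt_jk; rewrite eq_jk ltnNge (leq_trans (leqnSn k)).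
- by rewrite k_a -j_a eqxx in neq_jk.
Qed.

(** Reading indices modulo [l] includes the return to the starting vertex at
    [k = l]. *)
Lemma is_cycle_word n l (s : seq {set 'I_n}) : is_cycle (hypercube n) l s ->
  exists A w, [/\ size w = l, foldl (@flip n) A w = A &
    forall k, k <= l -> nth A s (k %% l) = foldl (@flip n) A (take k w)].
Proof.
case=> l_gt2 sz_s /andP[+ _].
case def_s: s sz_s => [|A p] sz_s; first by rewrite -sz_s in l_gt2.
move=> /path_walk[w def_w]; exists A, w.
have sz_w : size w = l by rewrite -(size_scanl (@flip n) A) -def_w size_rcons.
have vertex k : k < l -> nth A s k = foldl (@flip n) A (take k w).
  case: k => [|k] lt_k; first by rewrite def_s take0.
  have <- : nth A (scanl (@flip n) A w) k = foldl (@flip n) A (take k.+1 w).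
    by rewrite nth_scanl // sz_w ltnW.
  rewrite -def_w nth_rcons; move: lt_k; rewrite -sz_s /= ltnS => lt_k.
  by rewrite def_s lt_k.
have closed_w : foldl (@flip n) A w = A.
  have := congr1 (last A) def_w; rewrite last_rcons (last_nth A) size_scanl.
  case: (w) => //= i u; rewrite -[_ :: _]/(scanl (@flip n) A (i :: u)).
  by rewrite nth_scanl //= take_size.
split=> // k; rewrite leq_eqVlt -def_s.
case/predU1P=> [->|lt_k]; last by rewrite modn_small ?vertex.
by rewrite modnn vertex ?(ltn_trans _ l_gt2) // take0 -sz_w take_size closed_w.
Qed.

Theorem theorem1p1 (n : nat) (hn : 0 < n) :
  exists c : edge (hypercube n) -> 'I_4,
    forall l : nat, l \in [:: 4; 6; 10] ->
      forall s : seq {set 'I_n},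
        induced_cycle (hypercube n) l s -> ~ monochromatic c s.
Proof.
exists (fun e => parity_colour (val e)) => l l_val s ind_s [colour mono_s].
have [cycle_s _] := ind_s; have [_ sz_s /andP[_ uniq_s]] := cycle_s.
have [A [w [sz_w closed_w vertex]]] := is_cycle_word cycle_s.
have vertex_lt k : k < l -> nth A s k = foldl (@flip n) A (take k w).
  by move=> lt_k; rewrite -vertex ?modn_small // ltnW.
have colour_w v i u : w = v ++ i :: u ->
  let B := foldl (@flip n) A v in parity_colour [set B; flip B i] = colour.
  move=> eq_w B.
  have lt_v : size v < l by rewrite -sz_w eq_w size_cat /= -addSnnS leq_addr.
  have edge_B : [set B; flip B i] \in edge_set (hypercube n).
    by apply/imsetP; exists (B, flip B i); rewrite // inE; apply/hypercubeP; exists i.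
  pose e : edge (hypercube n) := exist (fun a => a \in edge_set (hypercube n)) _ edge_B.
  apply: (mono_s e); apply/imsetP; exists (nth A s (size v)).
    by rewrite mem_nth ?sz_s.
  rewrite /= next_nth_mod ?sz_s // vertex // vertex_lt // eq_w.
  rewrite take_size_cat // -cat_rcons take_size_cat ?size_rcons //.
  by rewrite foldl_rcons.
have even_w a : ~~ odd (count_mem a (map val w)).
  apply/negP => odd_a; have : a \in map val w by rewrite -has_pred1 has_count odd_gt0.
  case/mapP => i _ eq_a; move: odd_a; rewrite count_map.
  rewrite (eq_count (a2 := pred1 i)) => [|j]; last by rewrite /= eq_a val_eqE.
  by have := in_walk A w i; rewrite closed_w; case: (i \in A); case: (odd _).
apply: (negP (no_admissible_closed_word l_val _ even_w)); rewrite ?size_map //.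
apply: admissible_arcs => [v u t eq_w u_gt1 lt_ul|v i u t eq_w].
  apply/negP => /(nearly_closed_walk (foldl (@flip n) A v)).
  have le_l : size v + size u <= l.
    by rewrite -sz_w eq_w !size_cat addnA leq_addr.
  have := @induced_cycle_chord _ _ _ _ A (size v) (size v + size u) ind_s.
  rewrite vertex // vertex_lt; last first.
    by apply: leq_trans le_l; rewrite -[X in X < _]addn0 ltn_add2l ltnW.
  rewrite eq_w take_size_cat // catA take_size_cat ?size_cat // foldl_cat.
  rewrite -[(size v).+1]addn1 -[(size v + size u).+1]addnS !ltn_add2l.
  move=> /(_ u_gt1 le_l lt_ul)[neq not_adj] [eq_B|adj]; first by apply: neq.
  by rewrite adj in not_adj.
apply: (@parity_colour_balanced _ (foldl (@flip n) A v)).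
rewrite (colour_w _ _ _ eq_w) -[flip _ i]foldl_rcons -!foldl_cat.
symmetry; apply: (colour_w _ _ t).
by rewrite eq_w -catA cat_rcons.
Qed.
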